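(* Let $m,n\ge2$ and let $G$ be a grid-labelled graph of type $(m,n)$ (possibly with additional horizontal and vertical edges). (1) If $G$ has exactly two diagonal edges, then $\rho(G)$ is separable if and only if these two edges are $\{(i,j),(k,l)\}$ and $\{(i,l),(k,j)\}$ for some rows $i\neq k$ and columns $j\neq l$. (2) If $G$ has exactly three diagonal edges, then $\rho(G)$ is separable if and only if either (a) there are rows $i\neq k$ and pairwise distinct columns $j_1,j_2,j_3$ such that the diagonal edges are $\{(i,j_1),(k,j_2)\}$, $\{(i,j_2),(k,j_3)\}$, $\{(k,j_1),(i,j_3)\}$; or (b) there are pairwise distinct rows $i_1,i_2,i_3$ and columns $j\neq l$ such that the diagonal edges are $\{(i_1,j),(i_2,l)\}$, $\{(i_2,j),(i_3,l)\}$, $\{(i_1,l),(i_3,j)\}$.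
   Context: A grid-labelled graph of type $(a,b)$ is a simple graph $G$ whose vertex set is the grid $[a]\times[b]$. If $G$ has $m\ge1$ edges, $\rho(G)=L(G)/(2m)$, where $L(G)$ is the combinatorial Laplacian, viewed as a density matrix on $\mathbb{C}^a\otimes\mathbb{C}^b$ with vertex $(i,j)$ corresponding to $|i\rangle\otimes|j\rangle$; separable means a convex combination of tensor products of density matrices. An edge $\{(i,j),(k,l)\}$ is horizontal if $i=k$, vertical if $j=l$, and diagonal if $i\neq k$ and $j\neq l$. *)

(* Defs.v *)
From HB Require Import structures.
From mathcomp Require Import all_boot all_order all_algebra.
Set Implicit Arguments. Unset Strict Implicit. Unset Printing Implicit Defensive.
Import Order.TTheory GRing.Theory Num.Theory.
Local Open Scope ring_scope.

(* Operators on the finite-dimensional Hilbert space C^T with orthonormal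
   basis (|x>)_{x : T}, represented by their matrix entries  M x y = <x|M|y>.
   C is an (ordered) algebraically closed field with conjugation, e.g. algC. *)
Definition op (C : numClosedFieldType) (T : finType) := T -> T -> C.

Definition hermitian_op (C : numClosedFieldType) (T : finType) (M : op C T) :=
  forall x y, M y x = (M x y)^*.

Definition psd_op (C : numClosedFieldType) (T : finType) (M : op C T) :=
  hermitian_op M /\
  forall v : T -> C, 0 <= \sum_(x : T) \sum_(y : T) (v x)^* * M x y * v y.

Definition trace_op (C : numClosedFieldType) (T : finType) (M : op C T) :=
  \sum_(x : T) M x x.

Definition density_op (C : numClosedFieldType) (T : finType) (M : op C T) :=
  psd_op M /\ trace_op M = 1.

Definition tensor_op (C : numClosedFieldType) (A B : finType)
  (X : op C A) (Y : op C B) : op C (A * B)%type :=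
  fun p q => X p.1 q.1 * Y p.2 q.2.

Definition separable (C : numClosedFieldType) (a b : nat)
  (rho : op C ('I_a * 'I_b)%type) :=
  exists (N : nat) (p : 'I_N -> C) (X : 'I_N -> op C 'I_a) (Y : 'I_N -> op C 'I_b),
    [/\ forall k, 0 <= p k,
        \sum_(k < N) p k = 1,
        forall k, density_op (X k),
        forall k, density_op (Y k) &
        forall u v, rho u v = \sum_(k < N) p k * tensor_op (X k) (Y k) u v].

(* grid-labelled graphs of type (a,b): simple graphs on [a] x [b],
   given by a symmetric irreflexive adjacency relation *)
Definition vert (a b : nat) := ('I_a * 'I_b)%type.

Definition simple_graph (T : finType) (e : rel T) :=
  (forall x, ~~ e x x) /\ (forall x y, e x y = e y x).

Definition edges (T : finType) (e : rel T) : {set {set T}} :=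
  [set E : {set T} | [exists x, exists y, e x y && (E == [set x; y])]].

Definition num_edges (T : finType) (e : rel T) : nat := #|edges e|.

Definition degree (T : finType) (e : rel T) (x : T) : nat := #|[set y | e x y]|.

Definition laplacian (C : numClosedFieldType) (T : finType) (e : rel T) : op C T :=
  fun x y => if x == y then (degree e x)%:R else if e x y then -1 else 0.

Definition rho (C : numClosedFieldType) (a b : nat) (e : rel (vert a b))
  : op C (vert a b) :=
  fun x y => laplacian C e x y / (2 * num_edges e)%:R.

Definition diag_edges (a b : nat) (e : rel (vert a b)) : {set {set vert a b}} :=
  [set E : {set vert a b} | [exists x, exists y,
     [&& e x y, x.1 != y.1, x.2 != y.2 & E == [set x; y]]]].

(* Main.v *)
Require Import Defs.
From mathcomp Require Import all_boot all_order all_algebra.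
From mathcomp Require Import cyclic ring.
From mathcomp Require separable cyclotomic.
Set Implicit Arguments. Unset Strict Implicit. Unset Printing Implicit Defensive.
Import Order.TTheory GRing.Theory Num.Theory.
Local Open Scope ring_scope.

(* Necessity is the degree criterion.  The all-ones vector is a product vector
   in the kernel of L(G), so it also lies in the kernel of the partial transpose
   of rho(G): every vertex has the same degree in G and in the graph obtained
   by replacing each edge {(i, j), (k, l)} by {(i, l), (k, j)}.  Only diagonal
   edges move, and two or three of them can balance each other only in the
   listed ways.  Conversely, L(G) is the sum of the Laplacians of its edges.
   Horizontal and vertical edges give product vectors, and each listed
   configuration is, up to transposing the grid, a cycle
   {(i, f 0), (k, f 1)}, ..., {(i, f (N-1)), (k, f N)} with f N = f 0, whose
   Laplacian is a sum of product projectors by discrete Fourier transform. *)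

Section Operators.
Variable C : numClosedFieldType.

Definition delta (T : finType) (x y : T) : C := (y == x)%:R.

Definition op_apply (T : finType) (M : op C T) (v : T -> C) (x : T) : C :=
  \sum_y M x y * v y.

Definition op_form (T : finType) (M : op C T) (u v : T -> C) : C :=
  \sum_x (u x)^* * op_apply M v x.

Definition normsq (T : finType) (v : T -> C) : C := \sum_x v x * (v x)^*.

Definition ketbra (T : finType) (v : T -> C) : op C T :=
  fun x y => v x * (v y)^*.

Definition tensor_vec (A B : finType) (u : A -> C) (v : B -> C)
  : (A * B)%type -> C :=
  fun p => u p.1 * v p.2.

Lemma sum_delta (T : finType) (x : T) (F : T -> C) :
  \sum_y delta x y * F y = F x.
Proof.
under eq_bigr do rewrite /delta mulr_natl mulrb.
by rewrite -big_mkcond big_pred1_eq.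
Qed.

Lemma conj_delta (T : finType) (x y : T) : (delta x y)^* = delta x y.
Proof. exact: conjC_nat. Qed.

Lemma delta_pair (A B : finType) (a : A) (b : B) u :
  delta (a, b) u = tensor_vec (delta a) (delta b) u.
Proof.
by case: u => a' b'; rewrite /tensor_vec /delta xpair_eqE -mulnb natrM.
Qed.

Lemma sum_tensor (A B : finType) (f : A -> C) (g : B -> C) :
  \sum_u f u.1 * g u.2 = (\sum_a f a) * (\sum_b g b).
Proof.
rewrite mulr_suml -(pair_bigA _ (fun a b => f a * g b)) /=.
by apply: eq_bigr => a _; rewrite mulr_sumr.
Qed.

Lemma tensor_op_apply (A B : finType) (X : op C A) (Y : op C B) u v p :
  op_apply (tensor_op X Y) (tensor_vec u v) p =
  tensor_vec (op_apply X u) (op_apply Y v) p.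
Proof.
rewrite /tensor_vec /op_apply -sum_tensor; apply: eq_bigr => q _.
by rewrite /tensor_op; ring.
Qed.

Lemma tensor_op_form (A B : finType) (X : op C A) (Y : op C B) u v :
  op_form (tensor_op X Y) (tensor_vec u v) (tensor_vec u v) =
  op_form X u u * op_form Y v v.
Proof.
rewrite /op_form -sum_tensor; apply: eq_bigr => p _.
by rewrite tensor_op_apply /tensor_vec rmorphM; ring.
Qed.

Lemma sqrtC_mul_conj (c : C) : 0 <= c -> sqrtC c * (sqrtC c)^* = c.
Proof. by move=> c_ge0; rewrite geC0_conj ?sqrtC_ge0 // -expr2 sqrtCK. Qed.

Lemma normsq_ge0 (T : finType) (v : T -> C) : 0 <= normsq v.
Proof. by apply: sumr_ge0 => x _; rewrite mul_conjC_ge0. Qed.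

Lemma normsq_eq0 (T : finType) (v : T -> C) x : normsq v = 0 -> v x = 0.
Proof.
move=> v0; apply/eqP; rewrite -mul_conjC_eq0; apply/eqP.
by apply: (psumr_eq0P _ v0) => // y _; rewrite mul_conjC_ge0.
Qed.

Lemma normsq_tensor (A B : finType) (u : A -> C) (v : B -> C) :
  normsq (tensor_vec u v) = normsq u * normsq v.
Proof.
rewrite /normsq -sum_tensor; apply: eq_bigr => p _.
by rewrite /tensor_vec rmorphM; ring.
Qed.

Lemma tensor_ketbra (A B : finType) (u : A -> C) (v : B -> C) p q :
  tensor_op (ketbra u) (ketbra v) p q = ketbra (tensor_vec u v) p q.
Proof. by rewrite /tensor_op /ketbra /tensor_vec rmorphM; ring. Qed.

Lemma density_ketbra (T : finType) (v : T -> C) :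
  normsq v = 1 -> density_op (ketbra v).
Proof.
move=> v1; split=> //; split=> [x y|u].
  by rewrite /ketbra rmorphM /= conjCK mulrC.
have -> : \sum_x \sum_y (u x)^* * ketbra v x y * u y =
    (\sum_x (u x)^* * v x) * (\sum_x (u x)^* * v x)^*.
  rewrite rmorph_sum mulr_suml; apply: eq_bigr => x _.
  rewrite mulr_sumr; apply: eq_bigr => y _.
  by rewrite /ketbra rmorphM /= conjCK; ring.
exact: mul_conjC_ge0.
Qed.

(* The zero vector is normalized to [delta x0]. *)
Definition normalize (T : finType) (x0 : T) (v : T -> C) : T -> C :=
  if normsq v == 0 then delta x0 else fun x => v x / sqrtC (normsq v).

Lemma ketbra_normalize (T : finType) (x0 : T) (v : T -> C) x y :
  ketbra v x y = normsq v * ketbra (normalize x0 v) x y.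
Proof.
rewrite /normalize; case: eqP => [v0 | /eqP v_neq0].
  by rewrite v0 mul0r /ketbra (normsq_eq0 x v0) mul0r.
rewrite /ketbra rmorphM fmorphV /= mulrACA -invfM sqrtC_mul_conj ?normsq_ge0 //.
by rewrite [RHS]mulrC divfK.
Qed.

Lemma normsq_normalize (T : finType) (x0 : T) (v : T -> C) :
  normsq (normalize x0 v) = 1.
Proof.
have [v0 | v_neq0] := eqVneq (normsq v) 0.
  by rewrite /normalize v0 eqxx /normsq sum_delta conj_delta /delta eqxx.
apply: (mulfI v_neq0); rewrite mulr1 mulr_sumr; apply: eq_bigr => x _.
exact/esym/ketbra_normalize.
Qed.

End Operators.

(** * The cone of separable operators *)

Section SeparableCone.
Variable C : numClosedFieldType.

Definition separable_cone (A B : finType) (M : op C (A * B)%type) :=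
  exists s : seq ((A -> C) * (B -> C)),
    forall p q, M p q = \sum_(t <- s) ketbra (tensor_vec t.1 t.2) p q.

Section ConeOperations.
Variables A B : finType.
Implicit Types M : op C (A * B)%type.

Lemma eq_separable_cone M M' :
  (forall p q, M p q = M' p q) -> separable_cone M -> separable_cone M'.
Proof. by move=> eqM [s Ms]; exists s => p q; rewrite -eqM. Qed.

Lemma separable_cone_ketbra (u : A -> C) (v : B -> C) :
  separable_cone (ketbra (tensor_vec u v)).
Proof. by exists [:: (u, v)] => p q; rewrite big_seq1. Qed.

Lemma separable_coneD M M' :
  separable_cone M -> separable_cone M' ->
  separable_cone (fun p q => M p q + M' p q).
Proof.
by move=> [s Ms] [s' Ms']; exists (s ++ s') => p q; rewrite big_cat Ms Ms'.
Qed.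

Lemma separable_coneZ (c : C) M :
  0 <= c -> separable_cone M -> separable_cone (fun p q => c * M p q).
Proof.
move=> c_ge0 [s Ms].
exists [seq (fun a => sqrtC c * t.1 a, t.2) | t <- s] => p q.
rewrite Ms big_map mulr_sumr; apply: eq_bigr => t _.
by rewrite /ketbra /tensor_vec -[in LHS](sqrtC_mul_conj c_ge0) !rmorphM /=; ring.
Qed.

Lemma separable_cone_sum (I : Type) (r : seq I) (P : pred I)
    (M_ : I -> op C (A * B)%type) :
  (forall i, P i -> separable_cone (M_ i)) ->
  separable_cone (fun p q => \sum_(i <- r | P i) M_ i p q).
Proof.
move=> coneM; elim: r => [|i r IHr].
  by exists [::] => p q; rewrite !big_nil.
have [Pi | notPi] := boolP (P i).
  apply: eq_separable_cone (separable_coneD (coneM i Pi) IHr) => p q.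
  by rewrite big_cons Pi.
by apply: eq_separable_cone IHr => p q; rewrite big_cons (negPf notPi).
Qed.

End ConeOperations.

Lemma separable_cone_swap (A B : finType) (M : op C (A * B)%type) :
  separable_cone M ->
  separable_cone (fun p q : B * A => M (p.2, p.1) (q.2, q.1)).
Proof.
case=> s Ms; exists [seq (t.2, t.1) | t <- s] => p q; rewrite Ms big_map.
by apply: eq_bigr => t _; rewrite /ketbra /tensor_vec /= ![t.2 _ * _]mulrC.
Qed.

Lemma separable_of_cone (m n : nat) (i0 : 'I_m) (j0 : 'I_n)
    (M : op C (vert m n)) :
  separable_cone M -> trace_op M = 1 -> separable M.
Proof.
case=> s Ms trM; pose t k := tnth (in_tuple s) k.
exists (size s), (fun k => normsq (t k).1 * normsq (t k).2).
exists (fun k => ketbra (normalize i0 (t k).1)).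
exists (fun k => ketbra (normalize j0 (t k).2)).
split=> [k||k|k|p q].
- by rewrite mulr_ge0 ?normsq_ge0.
- rewrite -trM /trace_op; under [RHS]eq_bigr do rewrite Ms.
  rewrite exchange_big [RHS]big_tnth; apply: eq_bigr => k _.
  by rewrite -normsq_tensor.
- exact/density_ketbra/normsq_normalize.
- exact/density_ketbra/normsq_normalize.
rewrite Ms big_tnth; apply: eq_bigr => k _.
rewrite -tensor_ketbra /tensor_op (ketbra_normalize i0 (t k).1).
by rewrite (ketbra_normalize j0 (t k).2); ring.
Qed.

End SeparableCone.

(** * Cyclic configurations *)

Section RootsOfUnity.
Variables (C : numClosedFieldType) (N : nat).

Lemma prim_root_exists : (0 < N)%N -> exists w : C, N.-primitive_root w.
Proof.
move=> N_gt0; have [r Dr] := closed_field_poly_normal ('X^N - 1 : {poly C}).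
rewrite (monicP (monicXnsubC _ N_gt0)) scale1r in Dr.
have size_r : size r = N.
  by apply/eqP; rewrite -eqSS -(size_prod_XsubC r id) -Dr size_XnsubC.
have r_unity : all N.-unity_root r.
  by apply/allP => z; rewrite -root_prod_XsubC -Dr.
have r_uniq : uniq r.
  rewrite -separable.separable_prod_XsubC -Dr cyclotomic.separable_Xn_sub_1 //.
  by rewrite pnatr_eq0 -lt0n.
have /hasP[w _ prim_w] : has N.-primitive_root r.
  by apply: has_prim_root N_gt0 r_unity r_uniq _; rewrite size_r.
by exists w.
Qed.

Variables (w : C) (prim_w : N.-primitive_root w).

Lemma prim_root_norm : `|w| = 1.
Proof.
have N_gt0 := prim_order_gt0 prim_w; apply/eqP.
by rewrite -(pexpr_eq1 N_gt0) // -normrX (prim_expr_order prim_w) normr1.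
Qed.

Lemma prim_root_orthogonality (s t : 'I_N) :
  \sum_(r < N) w ^+ (r * s) * (w ^+ (r * t))^* = if s == t then N%:R else 0.
Proof.
have unit_conj k : w ^+ k * (w ^+ k)^* = 1.
  by rewrite -normCK normrX prim_root_norm !expr1n.
have [-> | s_neq_t] := eqVneq s t.
  under eq_bigr do rewrite unit_conj.
  by rewrite sumr_const card_ord.
pose z := w ^+ s * (w ^+ t)^*.
have zN : z ^+ N = 1.
  by rewrite exprMn -rmorphXn -!exprM ![(_ * N)%N]mulnC !exprM
             (prim_expr_order prim_w) !expr1n rmorph1 mulr1.
have z_neq1 : z - 1 != 0.
  rewrite subr_eq0; apply: contra_neq s_neq_t => z1; apply/val_inj/eqP.
  rewrite -[val s](modn_small (ltn_ord s)) -[val t](modn_small (ltn_ord t)).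
  rewrite -(eq_prim_root_expr prim_w); apply/eqP.
  by rewrite -[RHS]mul1r -z1 /z mulrAC -mulrA unit_conj mulr1.
apply: (mulfI z_neq1); rewrite mulr0 -[RHS](subrr (1 : C)).
rewrite -[X in _ = X - 1]zN subrX1.
congr (_ * _); apply: eq_bigr => r _.
by rewrite /z exprMn -rmorphXn -!exprM ![(_ * r)%N]mulnC.
Qed.

Lemma sum_ketbra_fourier (T : finType) (v : 'I_N -> T -> C) x y :
  \sum_(r < N) ketbra (fun z => \sum_(t < N) w ^+ (r * t) * v t z) x y =
  N%:R * \sum_(t < N) ketbra (v t) x y.
Proof.
pose c (s t : 'I_N) := v s x * (v t y)^*.
transitivity (\sum_(s < N) \sum_(t < N)
    (\sum_(r < N) w ^+ (r * s) * (w ^+ (r * t))^*) * c s t); last first.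
  rewrite mulr_sumr; apply: eq_bigr => s _.
  rewrite (bigD1 s) //= [X in _ + X]big1 => [|t ts].
    by rewrite prim_root_orthogonality eqxx addr0.
  by rewrite prim_root_orthogonality eq_sym (negPf ts) mul0r.
under [RHS]eq_bigr do under eq_bigr do rewrite mulr_suml.
under [RHS]eq_bigr do rewrite exchange_big.
rewrite exchange_big; apply: eq_bigr => r _.
rewrite /ketbra rmorph_sum mulr_suml; apply: eq_bigr => s _.
rewrite mulr_sumr; apply: eq_bigr => t _.
by rewrite rmorphM /c /=; ring.
Qed.

End RootsOfUnity.

Section EdgeVectors.
Variable C : numClosedFieldType.

Definition edge_vec (T : finType) (x y z : T) : C := delta C x z - delta C y z.

Lemma eq_ketbra (T : finType) (u v : T -> C) : u =1 v -> ketbra u =2 ketbra v.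
Proof. by move=> uv x y; rewrite /ketbra !uv. Qed.

Lemma edge_vec_row (A B : finType) (a : A) (b b' : B) :
  edge_vec (a, b) (a, b') =1 tensor_vec (delta C a) (edge_vec b b').
Proof. by move=> u; rewrite /edge_vec !delta_pair /tensor_vec mulrBr. Qed.

Lemma edge_vec_col (A B : finType) (a a' : A) (b : B) :
  edge_vec (a, b) (a', b) =1 tensor_vec (edge_vec a a') (delta C b).
Proof. by move=> u; rewrite /edge_vec !delta_pair /tensor_vec mulrBl. Qed.

(* The Fourier transform of the edge vectors is a product vector: shifting the
   cycle by one step multiplies its Fourier coefficients by a scalar, which
   moves to the row factor. *)
Lemma fourier_row_cycle (A B : finType) (w : C) (N r : nat) (i k : A)
    (f : nat -> B) :
  w != 0 -> w ^+ N = 1 -> f N = f 0 ->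
  (fun z => \sum_(t < N) w ^+ (r * t) * edge_vec (i, f t) (k, f t.+1) z) =1
  tensor_vec (fun a => delta C i a - (w ^+ r)^-1 * delta C k a)
             (fun b => \sum_(t < N) w ^+ (r * t) * delta C (f t) b).
Proof.
move=> w_neq0 wN fN z; have wr_neq0 : w ^+ r != 0 by rewrite expf_neq0.
have shift : \sum_(t < N) w ^+ (r * t) * delta C (f t.+1) z.2 =
    (w ^+ r)^-1 * \sum_(t < N) w ^+ (r * t) * delta C (f t) z.2.
  apply: (mulfI wr_neq0); rewrite mulVKf // mulr_sumr.
  pose F t := w ^+ (r * t) * delta C (f t) z.2.
  transitivity (\sum_(t < N) F t.+1).
    by apply: eq_bigr => t _; rewrite /F mulnS exprD mulrA.
  apply: (addrI (F 0)); rewrite -(big_ord_recl N F) big_ord_recr addrC.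
  by rewrite /F /= fN muln0 mulnC exprM wN expr1n.
transitivity (\sum_(t < N) (delta C i z.1 * (w ^+ (r * t) * delta C (f t) z.2) -
    delta C k z.1 * (w ^+ (r * t) * delta C (f t.+1) z.2))).
  by apply: eq_bigr => t _; rewrite /edge_vec !delta_pair /tensor_vec; ring.
by rewrite sumrB -!mulr_sumr shift /tensor_vec /=; ring.
Qed.

Lemma separable_cone_row_cycle (A B : finType) (N : nat) (i k : A)
    (f : nat -> B) :
  (0 < N)%N -> f N = f 0 ->
  separable_cone (fun p q =>
    \sum_(t < N) ketbra (edge_vec (i, f t) (k, f t.+1)) p q).
Proof.
move=> N_gt0 fN; have [w prim_w] := prim_root_exists C N_gt0.
have N_neq0 : N%:R != 0 :> C by rewrite pnatr_eq0 -lt0n.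
have Ninv_ge0 : 0 <= N%:R^-1 :> C by rewrite invr_ge0 ler0n.
have w_neq0 : w != 0 by rewrite -normr_eq0 (prim_root_norm prim_w) oner_eq0.
have wN := prim_expr_order prim_w.
pose row_factor r a := delta C i a - (w ^+ r)^-1 * delta C k a.
pose column_factor r b := \sum_(t < N) w ^+ (r * t) * delta C (f t) b.
have := separable_coneZ Ninv_ge0 (separable_cone_sum (index_enum 'I_N)
  (fun r (_ : true) => separable_cone_ketbra (row_factor r) (column_factor r))).
apply: eq_separable_cone => p q; rewrite -[RHS](mulKf N_neq0).
rewrite -(sum_ketbra_fourier prim_w (fun t => edge_vec (i, f t) (k, f t.+1))).
congr (_ * _); apply: eq_bigr => r _.
by rewrite (eq_ketbra (fourier_row_cycle r i k w_neq0 wN fN)).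
Qed.

Lemma separable_cone_column_cycle (A B : finType) (N : nat) (j l : B)
    (f : nat -> A) :
  (0 < N)%N -> f N = f 0 ->
  separable_cone (fun p q =>
    \sum_(t < N) ketbra (edge_vec (f t, j) (f t.+1, l)) p q).
Proof.
move=> N_gt0 fN.
apply: eq_separable_cone
  (separable_cone_swap (separable_cone_row_cycle j l N_gt0 fN)) => p q.
apply: eq_bigr => t _; rewrite /ketbra /edge_vec !delta_pair /tensor_vec.
by rewrite ![delta C j _ * _]mulrC ![delta C l _ * _]mulrC.
Qed.

End EdgeVectors.

(** * Laplacians as sums over edges *)

Lemma eq_set2 (T : finType) (x y x' y' : T) :
  ([set x; y] == [set x'; y']) =
  ((x, y) == (x', y')) || ((x, y) == (y', x')).
Proof.
rewrite !xpair_eqE; apply/eqP/orP => [E|[]/andP[/eqP-> /eqP->] //]; last first.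
  by rewrite setUC.
have := set22 x' y'; have := set21 x' y'; rewrite -E !inE.
have := set22 x y; have := set21 x y; rewrite {}E !inE.
case: (eqVneq x x') => [xx'|nx] /= xE yE x'E y'E.
  left; case/orP: yE => // /eqP yx'.
  by case/orP: y'E => /eqP ->; rewrite ?eqxx // yx' xx'.
by right; rewrite xE eq_sym.
Qed.

Section Laplacian.
Variables (C : numClosedFieldType) (T : finType).

Definition edge_laplacian (E : {set T}) : op C T :=
  fun x y => if (x \in E) && (y \in E) then if x == y then 1 else -1 else 0.

Lemma edge_laplacian_set2 (x y : T) :
  x != y -> edge_laplacian [set x; y] =2 ketbra (edge_vec C x y).
Proof.
move=> /negPf xy u v; rewrite /edge_laplacian /ketbra /edge_vec rmorphB /=.
rewrite !conj_delta /delta !inE.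
have [-> | ux] := eqVneq u x; have [-> | _] := eqVneq v x;
  rewrite ?eqxx ?xy /=.
- by ring.
- by case: (v == y) => /=; ring.
- by rewrite (negPf ux) andbT; case: (u == y) => /=; ring.
by have [-> | _] := eqVneq u y; case: (eqVneq v y) => _;
  rewrite ?eqxx /=; ring.
Qed.

Variables (e : rel T) (simple_e : simple_graph e).

Lemma edgesP E :
  reflect (exists x y, e x y /\ E = [set x; y]) (E \in edges e).
Proof.
rewrite inE; apply: (iffP existsP) => [[x /existsP[y /andP[exy /eqP->]]]|].
  by exists x, y.
by case=> x [y [exy ->]]; exists x; apply/existsP; exists y; rewrite exy eqxx.
Qed.

Lemma mem_edges x y : ([set x; y] \in edges e) = e x y.
Proof.
have [_ sym] := simple_e; apply/edgesP/idP => [[a [b [eab /eqP]]]|exy].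
  by rewrite eq_set2 => /orP[] /eqP[-> ->] //; rewrite sym.
by exists x, y.
Qed.

Lemma edge_neq x y : e x y -> x != y.
Proof. by have [irr _] := simple_e; apply: contraTneq => ->; apply: irr. Qed.

Lemma degree_edges x : degree e x = #|[set E in edges e | x \in E]|.
Proof.
have inj : injective (fun y => [set x; y]).
  by move=> y z /eqP; rewrite eq_set2 => /orP[] /eqP[] // -> ->.
rewrite /degree -(card_imset _ inj); apply: eq_card => E; rewrite [RHS]inE.
apply/imsetP/andP => [[y]|[/edgesP[a [b [eab ->]]]]].
  by rewrite inE => exy ->; rewrite mem_edges set21.
rewrite !inE => /orP[] /eqP ->; first by exists b; rewrite ?inE.
by exists a; rewrite ?inE 1?setUC // -mem_edges setUC mem_edges.
Qed.

Lemma laplacian_edges x y :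
  laplacian C e x y = \sum_(E in edges e) edge_laplacian E x y.
Proof.
rewrite /laplacian /edge_laplacian; have [<- | xy] := eqVneq x y.
  rewrite degree_edges -sum1dep_card natr_sum.
  by rewrite -big_mkcondr; apply: eq_bigl => E; rewrite andbb.
have unique_edge E : E \in edges e -> x \in E -> y \in E -> E = [set x; y].
  case/edgesP=> a [b [_ ->]]; rewrite !inE => /orP[] /eqP xE /orP[] /eqP yE;
    by move: xy; rewrite xE yE ?eqxx // setUC.
have [exy | not_exy] := ifPn.
  rewrite (bigD1 [set x; y]) ?mem_edges //= set21 set22 big1 ?addr0 // => E.
  case/andP=> Ee; case: ifP => // /andP[xE yE].
  by rewrite (unique_edge E) ?eqxx.
rewrite big1 // => E Ee; case: ifP => // /andP[xE yE].
by move: (Ee); rewrite (unique_edge E) // mem_edges (negPf not_exy).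
Qed.

Lemma trace_laplacian : trace_op (laplacian C e) = (2 * num_edges e)%:R.
Proof.
rewrite /trace_op; under eq_bigr do rewrite laplacian_edges.
rewrite exchange_big mulnC natrM mulr_natl -sumr_const.
apply: eq_bigr => E /edgesP[x [y [exy ->]]].
have <- : #|[set x; y]| = 2%N by rewrite cards2 edge_neq.
rewrite -sum1_card natr_sum [RHS]big_mkcond; apply: eq_bigr => z _.
by rewrite /edge_laplacian andbb eqxx.
Qed.

End Laplacian.

(** * Diagonal edges of grid-labelled graphs *)

Section DiagonalEdges.
Variables A B : finType.
Implicit Types (e : rel (A * B)%type) (x y : (A * B)%type).

Definition off_axis x y := (x.1 != y.1) && (x.2 != y.2).

Definition diag e : rel (A * B)%type := fun x y => e x y && off_axis x y.

Lemma off_axis_sym x y : off_axis x y = off_axis y x.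
Proof. by rewrite /off_axis eq_sym [x.2 == _]eq_sym. Qed.

Lemma simple_diag e : simple_graph e -> simple_graph (diag e).
Proof.
case=> irr sym; split=> [x|x y]; first by rewrite /diag negb_and irr.
by rewrite /diag sym off_axis_sym.
Qed.

Lemma edges_diag_sub e : edges (diag e) \subset edges e.
Proof.
apply/subsetP => E /edgesP[x [y [/andP[exy _] ->]]].
by apply/edgesP; exists x, y.
Qed.

End DiagonalEdges.

Lemma diag_edgesE (m n : nat) (e : rel (vert m n)) :
  diag_edges e = edges (diag e).
Proof.
apply/setP => E; rewrite !inE; apply: eq_existsb => x; apply: eq_existsb => y.
by rewrite /diag /off_axis -!andbA.
Qed.

Section SeparableGraphs.
Variables (C : numClosedFieldType) (m n : nat) (e : rel (vert m n)).
Hypothesis simple_e : simple_graph e.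

Lemma trace_rho : (0 < num_edges e)%N -> trace_op (rho C e) = 1.
Proof.
move=> e_gt0; rewrite /trace_op -mulr_suml -/(trace_op _) trace_laplacian //.
by rewrite divff // pnatr_eq0 muln_eq0 -lt0n.
Qed.

Lemma separable_cone_axis_edge E :
  E \in edges e -> E \notin edges (diag e) ->
  separable_cone (edge_laplacian C E).
Proof.
case/edgesP=> -[i j] [[k l] [eE ->]].
rewrite (mem_edges (simple_diag simple_e)) /diag eE /off_axis /=.
rewrite negb_and !negbK => on_axis.
have cone_ketbra : separable_cone (ketbra (edge_vec C (i, j) (k, l))).
  case/orP: on_axis => /eqP <-.
    apply: eq_separable_cone
      (separable_cone_ketbra (delta C i) (edge_vec C j l)) => p q.
    by rewrite (eq_ketbra (edge_vec_row C i j l)).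
  apply: eq_separable_cone
    (separable_cone_ketbra (edge_vec C i k) (delta C j)) => p q.
  by rewrite (eq_ketbra (edge_vec_col C i k j)).
apply: eq_separable_cone cone_ketbra => p q.
by rewrite edge_laplacian_set2 // (edge_neq simple_e).
Qed.

Lemma separable_rho_of_diag_cone :
  (0 < num_edges e)%N ->
  separable_cone (fun p q =>
    \sum_(E in edges (diag e)) edge_laplacian C E p q) ->
  separable (rho C e).
Proof.
move=> e_gt0 diag_cone.
have [[i j] _] : exists x, exists y, e x y.
  by case/card_gt0P: e_gt0 => E /edgesP[x [y [exy _]]]; exists x, y.
apply: separable_of_cone (trace_rho e_gt0) => //.
have scale_ge0 : 0 <= (2 * num_edges e)%:R^-1 :> C by rewrite invr_ge0.
have axis_cone : separable_cone (fun p q =>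
    \sum_(E in edges e | E \notin edges (diag e)) edge_laplacian C E p q).
  by apply: separable_cone_sum => E /andP[]; apply: separable_cone_axis_edge.
apply: eq_separable_cone
  (separable_coneZ scale_ge0 (separable_coneD diag_cone axis_cone)) => p q.
rewrite /rho laplacian_edges // mulrC; congr (_ / _).
rewrite [RHS](bigID (mem (edges (diag e)))) /=; congr (_ + _).
by apply: eq_bigl => E; rewrite andb_idl //; apply/subsetP/edges_diag_sub.
Qed.

Lemma separable_rho_of_edge_cone (x y : nat -> vert m n) (N : nat) :
  (0 < N)%N -> #|diag_edges e| = N ->
  diag_edges e =i mkseq (fun t => [set x t; y t]) N ->
  separable_cone (fun p q =>
    \sum_(t < N) ketbra (edge_vec C (x t) (y t)) p q) ->
  separable (rho C e).
Proof.
rewrite diag_edgesE => N_gt0 cardD memD edge_cone.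
have diag_xy (t : 'I_N) : diag e (x t) (y t).
  rewrite -(mem_edges (simple_diag simple_e)) memD.
  by apply/mapP; exists (val t); rewrite // mem_iota ltn_ord.
apply: separable_rho_of_diag_cone.
  by apply: leq_trans (subset_leq_card (edges_diag_sub e)); rewrite cardD.
apply: eq_separable_cone edge_cone => p q.
transitivity (\sum_(E <- mkseq (fun t => [set x t; y t]) N)
                edge_laplacian C E p q).
  rewrite big_map -[N in iota _ N]subn0 big_mkord; apply: eq_bigr => t _.
  by rewrite edge_laplacian_set2 // (edge_neq (simple_diag simple_e)) ?diag_xy.
rewrite big_uniq; first by apply: eq_bigl => E; rewrite memD.
by apply/card_uniqP; rewrite -(eq_card memD) cardD size_mkseq.
Qed.

Lemma separable_row_cycle (i k : 'I_m) (f : nat -> 'I_n) (N : nat) :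
  (0 < N)%N -> f N = f 0 -> #|diag_edges e| = N ->
  diag_edges e =i mkseq (fun t => [set (i, f t); (k, f t.+1)]) N ->
  separable (rho C e).
Proof.
move=> N_gt0 fN cardD memD; apply: separable_rho_of_edge_cone memD _ => //.
exact: separable_cone_row_cycle.
Qed.

Lemma separable_column_cycle (f : nat -> 'I_m) (j l : 'I_n) (N : nat) :
  (0 < N)%N -> f N = f 0 -> #|diag_edges e| = N ->
  diag_edges e =i mkseq (fun t => [set (f t, j); (f t.+1, l)]) N ->
  separable (rho C e).
Proof.
move=> N_gt0 fN cardD memD; apply: separable_rho_of_edge_cone memD _ => //.
exact: separable_cone_column_cycle.
Qed.

End SeparableGraphs.

(** * The degree criterion *)

Definition partial_transpose (A B : finType) (R : Type)
    (M : (A * B)%type -> (A * B)%type -> R)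
  : (A * B)%type -> (A * B)%type -> R :=
  fun x y => M (x.1, y.2) (y.1, x.2).

Lemma off_axis_partial_transpose (A B : finType) (x y : (A * B)%type) :
  partial_transpose (@off_axis A B) x y = off_axis x y.
Proof. by rewrite /partial_transpose /off_axis [y.2 == _]eq_sym. Qed.

Section Kernels.
Variable C : numClosedFieldType.

Lemma psd_form_ge0 (T : finType) (M : op C T) v :
  psd_op M -> 0 <= op_form M v v.
Proof.
case=> _ /(_ v); congr (_ <= _); apply: eq_bigr => x _.
by rewrite /op_apply mulr_sumr; apply: eq_bigr => y _; rewrite mulrA.
Qed.

Lemma op_form_conj (T : finType) (M : op C T) u v :
  hermitian_op M -> (op_form M u v)^* = op_form M v u.
Proof.
move=> herm; rewrite /op_form /op_apply rmorph_sum.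
under eq_bigr do rewrite rmorphM /= conjCK rmorph_sum mulr_sumr.
rewrite exchange_big; apply: eq_bigr => y _; rewrite mulr_sumr.
by apply: eq_bigr => x _; rewrite rmorphM /= -herm; ring.
Qed.

Lemma op_form_expand (T : finType) (M : op C T) u v c :
  op_form M (fun x => v x + c * u x) (fun x => v x + c * u x) =
  op_form M v v + c * op_form M v u + c^* * op_form M u v +
  c^* * c * op_form M u u.
Proof.
have applyDZ x : op_apply M (fun x => v x + c * u x) x =
    op_apply M v x + c * op_apply M u x.
  by rewrite /op_apply mulr_sumr -big_split; apply: eq_bigr => y _ /=; ring.
rewrite /op_form !mulr_sumr -!big_split; apply: eq_bigr => x _ /=.
by rewrite applyDZ rmorphD rmorphM /=; ring.
Qed.

(* Degenerate case of Cauchy-Schwarz: with z = <u, M v> and q = <u, M u>, the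
   form at v - z / (q + 1) u is - |z|^2 (q + 2) / (q + 1)^2. *)
Lemma psd_form_eq0 (T : finType) (M : op C T) u v :
  psd_op M -> op_form M v v = 0 -> op_form M u v = 0.
Proof.
move=> psdM v0; set z := op_form M u v; set q := op_form M u u.
have q_ge0 : 0 <= q := psd_form_ge0 u psdM.
have q1_neq0 : q + 1 != 0 by rewrite gt_eqF // ltr_wpDl.
have q1_real : (q + 1)^* = q + 1 by rewrite geC0_conj // addr_ge0.
have := psd_form_ge0 (fun x => v x + (- (z / (q + 1))) * u x) psdM.
rewrite op_form_expand v0 -/z -/q -(op_form_conj u v psdM.1) -/z.
rewrite rmorphN rmorphM fmorphV /= q1_real.
have -> : 0 + - (z / (q + 1)) * z^* + - (z^* / (q + 1)) * z +
    - (z^* / (q + 1)) * - (z / (q + 1)) * q =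
    - ((q + 2) / (q + 1) ^+ 2 * (z * z^*)) by field.
rewrite oppr_ge0 pmulr_rle0 => [z_le0|]; last first.
  by rewrite divr_gt0 ?exprn_gt0 // ltr_wpDl.
by apply/eqP; rewrite -mul_conjC_eq0 eq_le z_le0 mul_conjC_ge0.
Qed.

Lemma psd_kernel (T : finType) (M : op C T) v x :
  psd_op M -> op_form M v v = 0 -> op_apply M v x = 0.
Proof.
move=> psdM v0; rewrite -[RHS](psd_form_eq0 (delta C x) psdM v0).
by rewrite /op_form; under eq_bigr do rewrite conj_delta; rewrite sum_delta.
Qed.

Lemma op_apply_sum (T : finType) (N : nat) (c : 'I_N -> C) (M_ : 'I_N -> op C T)
    (M : op C T) v x :
  (forall y z, M y z = \sum_t c t * M_ t y z) ->
  op_apply M v x = \sum_t c t * op_apply (M_ t) v x.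
Proof.
move=> ME; rewrite /op_apply; under eq_bigr do rewrite ME mulr_suml.
rewrite exchange_big; apply: eq_bigr => t _; rewrite mulr_sumr.
by apply: eq_bigr => y _; rewrite mulrA.
Qed.

Lemma op_form_sum (T : finType) (N : nat) (c : 'I_N -> C) (M_ : 'I_N -> op C T)
    (M : op C T) u v :
  (forall y z, M y z = \sum_t c t * M_ t y z) ->
  op_form M u v = \sum_t c t * op_form (M_ t) u v.
Proof.
move=> ME; rewrite /op_form.
under eq_bigr do rewrite (op_apply_sum _ _ ME) mulr_sumr.
rewrite exchange_big; apply: eq_bigr => t _; rewrite mulr_sumr.
by apply: eq_bigr => x _; rewrite mulrCA.
Qed.

Lemma partial_transpose_tensor_apply (A B : finType) (X : op C A) (Y : op C B)
    u v p :
  hermitian_op Y ->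
  op_apply (partial_transpose (tensor_op X Y))
    (tensor_vec u (fun b => (v b)^*)) p =
  op_apply X u p.1 * (op_apply Y v p.2)^*.
Proof.
move=> hermY; rewrite /op_apply rmorph_sum -sum_tensor; apply: eq_bigr => q _.
by rewrite /partial_transpose /tensor_op /tensor_vec rmorphM /= -hermY; ring.
Qed.

(* A product vector in the kernel of a separable operator is killed, in each
   term X (x) Y of the decomposition, by X or by Y; conjugating the second
   factor preserves this. *)
Lemma separable_partial_transpose_kernel (m n : nat) (M : op C (vert m n))
    u v p :
  separable M -> op_form M (tensor_vec u v) (tensor_vec u v) = 0 ->
  op_apply (partial_transpose M) (tensor_vec u (fun b => (v b)^*)) p = 0.
Proof.
case=> N [c [X [Y [c_ge0 _ densX densY ME]]]].
have form_ge0 t : 0 <= c t * (op_form (X t) u u * op_form (Y t) v v).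
  have [[psdX _] [psdY _]] := (densX t, densY t).
  by rewrite !mulr_ge0 ?psd_form_ge0.
rewrite (op_form_sum _ _ ME); under eq_bigr do rewrite tensor_op_form.
move=> /psumr_eq0P form0.
rewrite (@op_apply_sum _ _ c
  (fun t => partial_transpose (tensor_op (X t) (Y t)))); last first.
  by move=> y z; apply: ME.
apply: big1 => t _; have [[psdX _] [psdY _]] := (densX t, densY t).
rewrite (partial_transpose_tensor_apply _ _ _ _ psdY.1).
have /eqP := form0 (fun t _ => form_ge0 t) t isT.
rewrite !mulf_eq0 => /or3P[/eqP -> | /eqP X0 | /eqP Y0]; first by rewrite mul0r.
  by rewrite (psd_kernel _ psdX X0) mul0r mulr0.
by rewrite (psd_kernel _ psdY Y0) conjC0 !mulr0.
Qed.

End Kernels.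

Lemma sum_laplacian_row (C : numClosedFieldType) (T : finType) (f : rel T)
    (c : C) x :
  ~~ f x x ->
  \sum_y (if x == y then c else if f x y then -1 else 0) = c - (degree f x)%:R.
Proof.
move=> fxx; rewrite (bigD1 x) //= eqxx; congr (_ + _).
rewrite /degree -sum1dep_card natr_sum -sumrN big_mkcond [RHS]big_mkcond.
apply: eq_bigr => y _; rewrite [x == y]eq_sym.
by case: eqVneq => [->|] //; rewrite (negPf fxx).
Qed.

Section DegreeCriterion.
Variables (C : numClosedFieldType) (m n : nat) (e : rel (vert m n)).
Hypothesis simple_e : simple_graph e.

Lemma degree_criterion x :
  (0 < num_edges e)%N -> separable (rho C e) ->
  degree (partial_transpose e) x = degree e x.
Proof.
have [irr sym] := simple_e => e_gt0 sep.
pose ones (T : Type) : T -> C := fun=> 1.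
have onesE u : tensor_vec (ones 'I_m) (ones 'I_n) u = 1.
  by rewrite /tensor_vec mulr1.
have form0 : op_form (rho C e) (tensor_vec (ones _) (ones _))
    (tensor_vec (ones _) (ones _)) = 0.
  apply: big1 => u _; rewrite /op_apply.
  under eq_bigr do rewrite onesE mulr1.
  by rewrite -mulr_suml sum_laplacian_row // subrr mul0r mulr0.
have := separable_partial_transpose_kernel x sep form0.
have -> : op_apply (partial_transpose (rho C e))
    (tensor_vec (ones _) (fun b => (ones _ b)^*)) x =
    ((degree e x)%:R - (degree (partial_transpose e) x)%:R) /
    (2 * num_edges e)%:R.
  rewrite -sum_laplacian_row ?irr // mulr_suml; apply: eq_bigr => y _.
  rewrite /tensor_vec conjC1 !mulr1 /partial_transpose /rho /laplacian.
  congr (_ / _).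
  rewrite xpair_eqE [y.2 == _]eq_sym -xpair_eqE -!surjective_pairing.
  by case: eqVneq => [<-|//]; rewrite -surjective_pairing.
move/eqP; rewrite mulf_eq0 invr_eq0 pnatr_eq0 muln_eq0 /= (gtn_eqF e_gt0) orbF.
by rewrite subr_eq0 eqr_nat => /eqP.
Qed.

Lemma diag_degree_criterion x :
  (0 < num_edges e)%N -> separable (rho C e) ->
  degree (partial_transpose (diag e)) x = degree (diag e) x.
Proof.
have [_ sym] := simple_e => e_gt0 sep.
have := degree_criterion x e_gt0 sep.
rewrite /degree -(cardsID [set y | off_axis x y]).
rewrite -[in RHS](cardsID [set y | off_axis x y]).
have -> : [set y | partial_transpose e x y] :\: [set y | off_axis x y] =
          [set y | e x y] :\: [set y | off_axis x y].
  apply/setP => y; rewrite !inE /partial_transpose.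
  case: (boolP (off_axis x y)) => //=; case: x y => [i j] [k l].
  by rewrite negb_and !negbK /= => /orP[] /eqP ->.
move/addIn; congr (_ = _); apply: eq_card => y; rewrite !inE //.
by rewrite -(off_axis_partial_transpose x).
Qed.

Lemma diag_partner x y :
  separable (rho C e) -> diag e x y ->
  exists z, partial_transpose (diag e) x z.
Proof.
move=> sep dxy; have e_gt0 : (0 < num_edges e)%N.
  case/andP: dxy => exy _; apply/card_gt0P; exists [set x; y].
  by rewrite mem_edges.
have : (0 < degree (partial_transpose (diag e)) x)%N.
  rewrite diag_degree_criterion //; apply/card_gt0P; exists y.
  by rewrite inE.
by case/card_gt0P=> z; rewrite inE; exists z.
Qed.

End DegreeCriterion.

(** * Configurations of two or three diagonal edges *)

Lemma eq_set3_of_card (T : finType) (S : {set T}) (x y z : T) :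
  #|S| = 3%N -> x \in S -> y \in S -> z \in S -> x != y -> x != z -> y != z ->
  S = [set x; y; z].
Proof.
move=> S3 xS yS zS xy xz yz; apply/esym/eqP.
rewrite eqEcard S3 !subUset !sub1set.
by rewrite xS yS zS -setUA cardsU1 !inE negb_or xy xz cards2 yz.
Qed.

Section Configurations.
Variables A B : finType.
Implicit Types (D : {set {set A * B}}) (x y z w : (A * B)%type).

Definition cross D :=
  exists (i k : A) (j l : B), [/\ i != k, j != l &
    D = [set [set (i, j); (k, l)]; [set (i, l); (k, j)]]].

Definition row_triple D :=
  exists (i k : A) (j1 j2 j3 : B),
    [/\ i != k, [&& j1 != j2, j1 != j3 & j2 != j3] &
      D = [set [set (i, j1); (k, j2)]; [set (i, j2); (k, j3)];
               [set (k, j1); (i, j3)]]].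

Definition column_triple D :=
  exists (i1 i2 i3 : A) (j l : B),
    [/\ [&& i1 != i2, i1 != i3 & i2 != i3], j != l &
      D = [set [set (i1, j); (i2, l)]; [set (i2, j); (i3, l)];
               [set (i1, l); (i3, j)]]].

Definition antidiag x z : {set A * B} := [set (x.1, z.2); (z.1, x.2)].

Lemma antidiag_eq_set2 x z y w :
  antidiag x z = [set y; w] -> x = (y.1, w.2) \/ x = (w.1, y.2).
Proof.
case: x z => [i j] [k l] /eqP.
by rewrite eq_set2 => /orP[] /eqP[<- <-]; [left | right].
Qed.

Lemma antidiag_eq x z y w : antidiag x z = antidiag y w -> x = y \/ x = w.
Proof. by move/antidiag_eq_set2; rewrite /= -!surjective_pairing. Qed.

Lemma antidiag_neq_set2 x y z : off_axis x z -> antidiag x z != [set x; y].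
Proof.
case: x z => [i j] [k l] /andP[/= ik jl].
apply: contraTneq (set21 (i, j) y) => <-.
by rewrite !inE !xpair_eqE (negPf ik) (negPf jl) andbF.
Qed.

Definition corners x y : {set A * B} := setX [set x.1; y.1] [set x.2; y.2].

Lemma diagonals_of_corners x y z w :
  off_axis z w -> z \in corners x y -> w \in corners x y ->
  ([set z; w] == [set x; y]) || ([set z; w] == antidiag x y).
Proof.
case: x y z w => [i j] [k l] [p q] [r s] /andP[/= pr qs].
rewrite /antidiag !inE /= => /andP[/orP[]/eqP pE /orP[]/eqP qE];
  move=> /andP[/orP[]/eqP rE /orP[]/eqP sE]; move: pr qs;
  by rewrite pE qE rE sE ?eqxx ?orbT // setUC eqxx ?orbT.
Qed.

Variable d : rel (A * B)%type.
Hypotheses (simple_d : simple_graph d)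
  (off_axis_d : forall x y, d x y -> off_axis x y)
  (partner_d : forall x y, d x y -> exists z, partial_transpose d x z).

Lemma exists_partner_edge x y : d x y ->
  exists z, [/\ off_axis x z, antidiag x z \in edges d
    & antidiag x z != [set x; y]].
Proof.
move=> dxy; have [z dxz] := partner_d dxy.
have off_xz : off_axis x z.
  by rewrite -off_axis_partial_transpose; apply: off_axis_d.
by exists z; rewrite off_xz mem_edges // antidiag_neq_set2.
Qed.

Lemma exists_partner_edges x y : d x y ->
  exists z w, [/\ off_axis x z, antidiag x z \in edges d,
    antidiag x z != [set x; y]
    & [/\ off_axis y w, antidiag y w \in edges d & antidiag y w != [set x; y]]].
Proof.
move=> dxy; have [z [xz xzD xz_neq]] := exists_partner_edge dxy.
have [|w [yw ywD yw_neq]] := @exists_partner_edge y x.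
  by rewrite simple_d.2.
by exists z, w; split=> //; split=> //; rewrite setUC.
Qed.

Lemma partner_edges_eq x y z w :
  off_axis x y -> antidiag y w = antidiag x z -> z = y.
Proof. by move=> /andP[xy _] /antidiag_eq[yx | //]; rewrite yx eqxx in xy. Qed.

Lemma cross_of_card2 : #|edges d| = 2%N -> cross (edges d).
Proof.
move=> card2.
have /card_gt0P[E /edgesP[x [y [dxy _]]]] : (0 < #|edges d|)%N.
  by rewrite card2.
have [z [w [_ xzD xz_neq [_ ywD yw_neq]]]] := exists_partner_edges dxy.
have edgesE : edges d = [set [set x; y]; antidiag x z].
  apply/esym/eqP; rewrite eqEcard subUset !sub1set mem_edges // dxy xzD.
  by rewrite card2 cards2 eq_sym xz_neq.
have zy : z = y.
  apply: (partner_edges_eq (off_axis_d dxy) (w := w)); apply/eqP.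
  by move: ywD; rewrite edgesE !inE (negPf yw_neq).
have /andP[xy1 xy2] := off_axis_d dxy.
exists x.1, y.1, x.2, y.2; split=> //.
by rewrite edgesE zy /antidiag -!surjective_pairing.
Qed.

Lemma third_edge_corner x y z w a b :
  edges d = [set [set x; y]; antidiag z w; [set a; b]] ->
  [\/ a = (x.1, y.2), a = (y.1, x.2), a = z | a = w].
Proof.
move=> edgesE; have dab : d a b by rewrite -mem_edges // edgesE !inE eqxx !orbT.
have [v [_ + /negPf v_neq]] := exists_partner_edge dab.
rewrite edgesE !inE v_neq orbF => /orP[] /eqP.
  by case/antidiag_eq_set2=> ->; [apply: Or41 | apply: Or42].
by case/antidiag_eq=> ->; [apply: Or43 | apply: Or44].
Qed.

Lemma antidiag_notin_of_card3 x y :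
  #|edges d| = 3%N -> d x y -> antidiag x y \notin edges d.
Proof.
move=> card3 dxy; apply/negP => xyD.
have dxyD : [set x; y] \in edges d by rewrite mem_edges.
have /subsetPn[E ED Enew] : ~~ (edges d \subset [set [set x; y]; antidiag x y]).
  by apply/negP => /subset_leq_card; rewrite card3 cards2; case: (_ != _).
have edgesE : edges d = [set [set x; y]; antidiag x y; E].
  move: Enew; rewrite !inE negb_or => /andP[E_xy E_anti].
  apply: eq_set3_of_card; rewrite // eq_sym //.
  exact/antidiag_neq_set2/off_axis_d.
have [a [b [dab E_ab]]] := edgesP _ _ ED; rewrite {}E_ab in edgesE Enew.
have corner v v' : edges d = [set [set x; y]; antidiag x y; [set v; v']] ->
    v \in corners x y.
  by case/third_edge_corner=> ->; rewrite !inE !eqxx ?orbT.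
case/negP: Enew; rewrite !inE; apply: diagonals_of_corners (off_axis_d dab) _ _.
  exact: corner edgesE.
by apply: (corner b a); rewrite edgesE [[set b; a]]setUC.
Qed.

Lemma triple_of_card3 :
  #|edges d| = 3%N -> row_triple (edges d) \/ column_triple (edges d).
Proof.
move=> card3.
have /card_gt0P[E /edgesP[x [y [dxy _]]]] : (0 < #|edges d|)%N.
  by rewrite card3.
have dxyD : [set x; y] \in edges d by rewrite mem_edges.
have [z [w [xz xzD xz_neq [yw ywD yw_neq]]]] := exists_partner_edges dxy.
have /andP[xy1 xy2] := off_axis_d dxy.
have z_neq_y : z <> y.
  by move=> zy; move: (antidiag_notin_of_card3 card3 dxy); rewrite -zy xzD.
have edgesE : edges d = [set [set x; y]; antidiag y w; antidiag x z].
  apply: eq_set3_of_card; rewrite // eq_sym //.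
  by apply/eqP => /esym/(partner_edges_eq (off_axis_d dxy)).
have partner_xz : z.2 = y.2 \/ w = (x.1, z.2).
  case: (third_edge_corner edgesE) => [[]|[xy _]|xy|->];
    [by left | | | by right].
    by rewrite xy eqxx in xy1.
  by rewrite -xy eqxx in xy1.
have partner_zx : z.1 = y.1 \/ w = (z.1, x.2).
  rewrite [antidiag x z]setUC in edgesE.
  case: (third_edge_corner edgesE) => [[_ xy]|[]|xy|->];
    [| by left | | by right].
    by rewrite xy eqxx in xy2.
  by rewrite -xy eqxx in xy2.
case: partner_xz partner_zx => [z2|wE] [z1|wE'].
- by case: z_neq_y; rewrite [z]surjective_pairing z1 z2 -surjective_pairing.
- right; exists x.1, y.1, z.1, x.2, y.2.
  have /andP[xz1 _] := xz; have /andP[yz1 _] := yw; rewrite wE' /= in yz1.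
  rewrite xy1 xz1 yz1 xy2; split=> //.
  by rewrite edgesE /antidiag wE' z2 /= -!surjective_pairing.
- left; exists x.1, y.1, x.2, y.2, z.2.
  have /andP[_ xz2] := xz; have /andP[_ yz2] := yw; rewrite wE /= in yz2.
  rewrite xy1 xy2 xz2 yz2; split=> //.
  rewrite edgesE /antidiag wE z1 /= -!surjective_pairing.
  by rewrite [[set (y.1, z.2); _]]setUC [[set (x.1, z.2); _]]setUC.
by have /andP[/negP[]] := xz; move: wE; rewrite wE' => -[->].
Qed.

End Configurations.

Section Classification.
Variables (C : numClosedFieldType) (m n : nat) (e : rel (vert m n)).
Hypothesis simple_e : simple_graph e.

Lemma separable_cross :
  #|diag_edges e| = 2%N -> cross (diag_edges e) -> separable (rho C e).
Proof.
move=> card2 [i [k [j [l [_ _ DE]]]]].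
pose f := nth j [:: j; l].
apply: (@separable_row_cycle _ _ _ _ simple_e i k f 2) => // E.
by rewrite DE !inE [[set (i, l); _]]setUC.
Qed.

Lemma separable_row_triple :
  #|diag_edges e| = 3%N -> row_triple (diag_edges e) -> separable (rho C e).
Proof.
move=> card3 [i [k [j1 [j2 [j3 [_ _ DE]]]]]].
pose f := nth j1 [:: j1; j2; j3].
apply: (@separable_row_cycle _ _ _ _ simple_e i k f 3) => // E.
by rewrite DE !inE orbA [[set (k, j1); _]]setUC.
Qed.

Lemma separable_column_triple :
  #|diag_edges e| = 3%N -> column_triple (diag_edges e) -> separable (rho C e).
Proof.
move=> card3 [i1 [i2 [i3 [j [l [_ _ DE]]]]]].
pose f := nth i1 [:: i1; i2; i3].
apply: (@separable_column_cycle _ _ _ _ simple_e f j l 3) => // E.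
by rewrite DE !inE orbA [[set (i1, l); _]]setUC.
Qed.

Lemma diag_off_axis x y : diag e x y -> off_axis x y.
Proof. by case/andP. Qed.

Lemma cross_of_separable :
  #|diag_edges e| = 2%N -> separable (rho C e) -> cross (diag_edges e).
Proof.
rewrite diag_edgesE => card2 sep.
apply: cross_of_card2 (simple_diag simple_e) diag_off_axis _ card2 => x y.
exact: diag_partner sep.
Qed.

Lemma triple_of_separable :
  #|diag_edges e| = 3%N -> separable (rho C e) ->
  row_triple (diag_edges e) \/ column_triple (diag_edges e).
Proof.
rewrite diag_edgesE => card3 sep.
apply: triple_of_card3 (simple_diag simple_e) diag_off_axis _ card3 => x y.
exact: diag_partner sep.
Qed.

End Classification.

Theorem mainTheorem12 (C : numClosedFieldType) (m n : nat)
  (e : rel (vert m n)) :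
  (1 < m)%N -> (1 < n)%N -> simple_graph e ->
  ((#|diag_edges e| = 2)%N ->
     (separable (rho C e) <->
      exists (i k : 'I_m) (j l : 'I_n), [/\ i != k, j != l &
        diag_edges e = [set [set (i, j); (k, l)]; [set (i, l); (k, j)]]])) /\
  ((#|diag_edges e| = 3)%N ->
     (separable (rho C e) <->
      (exists (i k : 'I_m) (j1 j2 j3 : 'I_n),
         [/\ i != k, [&& j1 != j2, j1 != j3 & j2 != j3] &
           diag_edges e = [set [set (i, j1); (k, j2)]; [set (i, j2); (k, j3)];
                               [set (k, j1); (i, j3)]]]) \/
      (exists (i1 i2 i3 : 'I_m) (j l : 'I_n),
         [/\ [&& i1 != i2, i1 != i3 & i2 != i3], j != l &
           diag_edges e = [set [set (i1, j); (i2, l)]; [set (i2, j); (i3, l)];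
                               [set (i1, l); (i3, j)]]]))).
Proof.
move=> _ _ simple_e; split=> card_diag; split.
- exact: cross_of_separable.
- exact: separable_cross.
- exact: triple_of_separable.
by case; [apply: separable_row_triple | apply: separable_column_triple].
Qed.
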